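(* For all integers $1\le k\le n$, the (images of the) $k$-th descent monomials $\{a_\pi^{(k)} : \pi\in S_n\}$ form a basis of the $\mathbf{Q}$-vector space $\mathbf{H}'_{(1^{k-1},n-k+1)}$.
   Context: Let $1\le k\le n$ and $\mathbf{Q}[\bar x,\bar y]=\mathbf{Q}[x_1,\dots,x_n,y_1,\dots,y_n]$. For the hook shape $\mu=(1^{k-1},n-k+1)$ (one row of length $n-k+1$ at the bottom and $k-1$ rows of length $1$ above it) let $\Delta_\mu$ be the determinant of the $n\times n$ matrix whose $i$-th row is $(1,y_i,y_i^2,\dots,y_i^{n-k},x_i,x_i^2,\dots,x_i^{k-1})$. Let $\mathbf{H}_\mu$ be the $\mathbf{Q}$-span of all partial derivatives (of all orders, including order $0$) of $\Delta_\mu$ with respect to the $x_i$ and $y_i$. Let $\langle f,g\rangle$ be the constant term of $f(\partial_{x_1},\dots,\partial_{x_n};\partial_{y_1},\dots,\partial_{y_n})\,g(\bar x;\bar y)$, let $J_\mu=\mathbf{H}_\mu^\perp=\{f\in\mathbf{Q}[\bar x,\bar y]:\langle f,g\rangle=0\ \forall g\in\mathbf{H}_\mu\}$ (an ideal), and let $\mathbf{H}'_\mu=\mathbf{Q}[\bar x,\bar y]/J_\mu$. For $\pi\in S_n$ let $\mathrm{Des}(\pi)=\{1\le i\le n-1:\pi(i)>\pi(i+1)\}$. The $k$-th descent monomial is $$a_\pi^{(k)}=\prod_{i\in \mathrm{Des}(\pi),\, i\le k-1}\bigl(x_{\pi(1)}\cdots x_{\pi(i)}\bigr)\cdot\prod_{i\in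 \mathrm{Des}(\pi),\, i\ge k}\bigl(y_{\pi(i+1)}\cdots y_{\pi(n)}\bigr).$$ *)

(* Defs.v *)
From HB Require Import structures.
From mathcomp Require Import all_boot all_order all_algebra.
From mathcomp Require Import perm ssrcomplements mpoly.
From mathcomp Require Import boolp.

Set Implicit Arguments.
Unset Strict Implicit.
Unset Printing Implicit Defensive.

Import GRing.Theory.
Local Open Scope ring_scope.
Local Open Scope quotient_scope.

Section Apolarity.
Variable N : nat.
Implicit Types (f g h : {mpoly rat[N]}) (m : 'X_{1..N}).

(* f(d/dz_1, .., d/dz_N) applied to g *)
Definition diffop f g : {mpoly rat[N]} :=
  \sum_(m <- msupp f) f@_m *: mderivm m g.

Definition pairing f g : rat := (diffop f g)@_0%MM.

Lemma diffopwE d f g : (msize f <= d)%N ->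
  diffop f g = \sum_(m : 'X_{1..N < d}) f@_m *: mderivm m g.
Proof.
move=> le_fd; rewrite /diffop (big_mksub 'X_{1..N < d}) //=; first last.
- by move=> m /msize_mdeg_lt /leq_trans; apply.
- by rewrite msupp_uniq.
rewrite big_rmcond //= => m /memN_msupp_eq0 ->.
by rewrite scale0r.
Qed.

Lemma diffop_linear g : linear (diffop^~ g).
Proof.
move=> c f1 f2.
pose d := maxn (maxn (msize f1) (msize f2)) (msize (c *: f1 + f2)).
have le1 : (msize f1 <= d)%N by rewrite !leq_max leqnn.
have le2 : (msize f2 <= d)%N by rewrite !leq_max leqnn orbT.
have le3 : (msize (c *: f1 + f2) <= d)%N by rewrite leq_max leqnn orbT.
rewrite (diffopwE _ le1) (diffopwE _ le2) (diffopwE _ le3).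
rewrite scaler_sumr -big_split.
by apply: eq_bigr => m _ /=; rewrite mcoeffD mcoeffZ scalerDl scalerA.
Qed.

Lemma diffopP g c f1 f2 :
  diffop (c *: f1 + f2) g = c *: diffop f1 g + diffop f2 g.
Proof. exact: diffop_linear. Qed.

Lemma diffop0 g : diffop 0 g = 0.
Proof. by rewrite /diffop msupp0 big_nil. Qed.

Lemma diffopX m g : diffop 'X_[m] g = mderivm m g.
Proof. by rewrite /diffop msuppX big_seq1 mcoeffX eqxx scale1r. Qed.

Lemma diffopXM m f g : diffop ('X_[m] * f) g = diffop f (mderivm m g).
Proof.
elim/mpolyind: f => [|c m' f _ _ IH]; first by rewrite mulr0 !diffop0.
rewrite mulrDr -scalerAr -mpolyXD !diffopP IH !diffopX.
by rewrite mderivmDm.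
Qed.

Lemma pairing_linear g : linear_for *%R (pairing^~ g).
Proof. by move=> c f1 f2; rewrite /pairing diffopP mcoeffD mcoeffZ. Qed.

End Apolarity.

(* Q[x_1..x_n, y_1..y_n]: the first n variables are the x's, the last n the
   y's. Indices of variables, rows and columns start at 0. *)
Definition xvar (n : nat) (i : 'I_n) : {mpoly rat[n + n]} := 'X_(lshift n i).
Definition yvar (n : nat) (i : 'I_n) : {mpoly rat[n + n]} := 'X_(rshift n i).

(* Row i is (1, y_i, .., y_i^(n-k), x_i, .., x_i^(k-1)). *)
Definition Delta (n k : nat) : {mpoly rat[n + n]} :=
  \det (\matrix_(i < n, j < n)
          if (j <= n - k)%N then yvar i ^+ j else xvar i ^+ (j - (n - k))).

Definition in_H (n k : nat) (g : {mpoly rat[n + n]}) : Prop :=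
  exists s : seq (rat * 'X_{1..n + n}),
    g = \sum_(a <- s) a.1 *: mderivm a.2 (Delta n k).

Definition J (n k : nat) : {pred {mpoly rat[n + n]}} :=
  fun f => `[< forall g, in_H k g -> pairing f g = 0 >].
Arguments J n k : clear implicits.

Lemma J_submod n k : submod_closed (J n k).
Proof.
split=> [|c f1 f2 /asboolP J1 /asboolP J2]; apply/asboolP=> g Hg.
  by rewrite /pairing diffop0 mcoeff0.
by rewrite pairing_linear J1 // J2 // mulr0 addr0.
Qed.

Lemma J_ideal n k (h f : {mpoly rat[n + n]}) : f \in J n k -> h * f \in J n k.
Proof.
have [J0 JP] := J_submod n k.
move=> Jf; elim/mpolyind: h => [|c m h _ _ IH]; first by rewrite mul0r.
rewrite mulrDl -scalerAl; apply: JP => //; move/asboolP: Jf => Jf.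
apply/asboolP=> _ [s ->]; rewrite /pairing diffopXM.
apply: Jf; exists [seq (a.1, (a.2 + m)%MM) | a <- s].
rewrite big_map raddf_sum; apply: eq_bigr => a _ /=.
by rewrite mderivmZ mderivmDm.
Qed.

HB.instance Definition _ n k :=
  GRing.isSubmodClosed.Build rat {mpoly rat[n + n]} (J n k) (J_submod n k).

Definition H' (n k : nat) : Type := {ideal_quot (J n k)}.

HB.instance Definition _ n k := GRing.Zmodule.on (H' n k).

Definition proj (n k : nat) (f : {mpoly rat[n + n]}) : H' n k :=
  \pi_{ideal_quot (J n k)} f.

Lemma proj_eq n k (f g : {mpoly rat[n + n]}) :
  (proj k f = proj k g) <-> (f - g \in J n k).
Proof. by rewrite Quotient.idealrBE; split=> [/eqP | /eqP]. Qed.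

Lemma projD n k (f g : {mpoly rat[n + n]}) :
  proj k (f + g) = proj k f + proj k g.
Proof. exact: (raddfD (\pi_{ideal_quot (J n k)})). Qed.

Lemma proj_surj n k (v : H' n k) : proj k (repr (v : {ideal_quot (J n k)})) = v.
Proof. exact: reprK. Qed.

Definition scaleH' n k (c : rat) (v : H' n k) : H' n k :=
  proj k (c *: repr (v : {ideal_quot (J n k)})).

Lemma scaleH'_proj n k c (f : {mpoly rat[n + n]}) :
  scaleH' c (proj k f) = proj k (c *: f).
Proof.
apply/proj_eq; rewrite -scalerBr rpredZ //.
by apply/proj_eq; rewrite proj_surj.
Qed.

Fact scaleH'A n k a b (v : H' n k) : scaleH' a (scaleH' b v) = scaleH' (a * b) v.
Proof. by rewrite -[v]proj_surj !scaleH'_proj scalerA. Qed.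

Fact scaleH'1 n k : left_id 1 (@scaleH' n k).
Proof. by move=> v; rewrite -[v]proj_surj scaleH'_proj scale1r. Qed.

Fact scaleH'Dr n k : right_distributive (@scaleH' n k) +%R.
Proof.
move=> a u v; rewrite -[u]proj_surj -[v]proj_surj.
by rewrite -projD !scaleH'_proj scalerDr projD.
Qed.

Fact scaleH'Dl n k v : {morph (@scaleH' n k)^~ v : a b / a + b}.
Proof.
by move=> a b; rewrite -[v]proj_surj !scaleH'_proj scalerDl projD.
Qed.

HB.instance Definition _ n k :=
  GRing.Zmodule_isLmodule.Build rat (H' n k)
    (@scaleH'A n k) (@scaleH'1 n k) (@scaleH'Dr n k) (@scaleH'Dl n k).

Fact proj_is_linear n k : linear (@proj n k).
Proof. by move=> c f g; rewrite projD -scaleH'_proj. Qed.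

HB.instance Definition _ n k :=
  GRing.isLinear.Build rat {mpoly rat[n + n]} (H' n k) _ (@proj n k)
    (@proj_is_linear n k).

(* The library's basis_of needs a vectType, i.e. finite dimension beforehand. *)
Definition is_basis (K : fieldType) (V : lmodType K) (I : finType)
    (e : I -> V) : Prop :=
  (forall c : I -> K, \sum_i c i *: e i = 0 -> forall i, c i = 0) /\
  (forall v : V, exists c : I -> K, v = \sum_i c i *: e i).

(* As positions start at 0, i \in Des p means that i + 1 is a descent in the
   usual 1-based convention. *)
Definition Des (n : nat) (p : 'S_n) : {set 'I_n} :=
  [set i : 'I_n | [exists j : 'I_n, (j == i.+1 :> nat) && (p j < p i)%N]].

Definition descent_monomial (n k : nat) (p : 'S_n) : {mpoly rat[n + n]} :=
  (\prod_(i in Des p | (i.+1 <= k - 1)%N) \prod_(j < n | (j <= i)%N) xvar (p j)) *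
  (\prod_(i in Des p | (k <= i.+1)%N) \prod_(j < n | (i < j)%N) yvar (p j)).

(* Main.v *)
Require Import Defs.
From mathcomp Require Import all_boot all_order all_algebra.
From mathcomp Require Import perm mpoly.
From mathcomp Require Import boolp.
From mathcomp Require Import zify.

Set Implicit Arguments.
Unset Strict Implicit.
Unset Printing Implicit Defensive.

Import Order.TTheory GRing.Theory Num.Theory.
Local Open Scope ring_scope.

(** A monomial with a factor [x_i y_i] pairs to zero with [Delta]. For the
others the pairing sees only the signed exponents (x-exponent minus y-exponent
at each index): it vanishes unless they are a rearrangement of
[k-1, ..., 1, 0, -1, ..., -(n-k)], each value taken once.
Both halves of the theorem sort signed exponents, breaking ties by the index.
The tie-break is built into integer keys, [n * z_i - i] or [n * z_i + i], so
that every comparison below is between integers that are pairwise distinct.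

Spanning is a straightening argument. Elementary symmetric polynomials of
positive degree in x alone or in y alone lie in the ideal ([esym_in_J]), and
so does every monomial that does not divide a monomial of [Delta]
([mon_notin_J]). Sort the signed exponents of a remaining monomial by a
permutation [p]; the value at position [k] is then zero ([pivot_zexp]). If each
consecutive drop is 1 at the descents of [p] and 0 elsewhere, the monomial is
the descent monomial of [p]. Otherwise some product of the first few x, or of
the last few y, in the order of [p], splits off as a factor; modulo the ideal
this factor is replaced by minus the sum of the other products of as many
variables of the same alphabet. Each replacement lowers the sum of the squared
keys, because the factor split off sat on the extreme keys ([potential_lt]).

Independence is a triangularity argument. To a permutation [s] attach the
complementary monomial, which cuts at the non-descents of [s] instead of the
descents; its product with the descent monomial of [s] is, up to sign, a
monomial of [Delta] ([pairing_full]). If the product of the descent monomial of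
[p] and the complementary monomial of [s] also pairs nontrivially with
[Delta], its signed exponents are sorted by a third permutation [r]. By the
rearrangement inequality ([rearrangement]) both factors have position-weighted
key sums along [r] at least as large as along their own orders [p] and [s],
while the two sums along [r] have a total independent of [p] and [s]. Hence the
weight of [p] is at most that of [s], with equality only for [p = s]
([pairing_triangular]). The pairing matrix is triangular with nonzero
diagonal. *)

(** * Apolar pairing with monomials *)

Lemma pairing_suml N (I : Type) (r : seq I) (P : pred I)
    (F : I -> {mpoly rat[N]}) (g : {mpoly rat[N]}) :
  pairing (\sum_(i <- r | P i) F i) g = \sum_(i <- r | P i) pairing (F i) g.
Proof.
elim/big_rec2: _ => [|i y f _ IH]; first by rewrite /pairing diffop0 mcoeff0.
by rewrite -[F i]scale1r pairing_linear mul1r IH scale1r.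
Qed.

Lemma pairing_sumr N (I : Type) (r : seq I) (f : {mpoly rat[N]})
    (c : I -> rat) (G : I -> {mpoly rat[N]}) :
  pairing f (\sum_(i <- r) c i *: G i) = \sum_(i <- r) c i * pairing f (G i).
Proof.
rewrite /pairing /diffop !raddf_sum /=.
under eq_bigr => m _ do rewrite mcoeffZ !raddf_sum /= mulr_sumr.
rewrite exchange_big /=; apply: eq_bigr => i _.
rewrite raddf_sum mulr_sumr; apply: eq_bigr => m _ /=.
by rewrite linearZ /= !mcoeffZ mulrCA.
Qed.

Lemma pairing_mderivm N (f g : {mpoly rat[N]}) (m : 'X_{1..N}) :
  pairing f (mderivm m g) = pairing ('X_[m] * f) g.
Proof. by rewrite /pairing diffopXM. Qed.

Lemma pairing_mon N (m1 m2 : 'X_{1..N}) :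
  pairing 'X_[m1] 'X_[m2] = ((m1 == m2) * \prod_(i < N) (m1 i)`!)%:R.
Proof.
rewrite /pairing diffopX mderivmX mcoeffZ mcoeffX.
case: (m1 =P m2) => [<-|neq].
  have -> : (m1 - m1 = 0)%MM by apply/mnmP=> i; rewrite mnmBE mnm0E subnn.
  rewrite eqxx mulr1 mul1n; congr _%:R.
  by apply: eq_bigr => i _; rewrite ffactnn.
rewrite mul0n; case: (boolP (m1 <= m2)%MM) => [le12|].
  case: eqP => [e0|]; last by rewrite mulr0.
  by case: neq; rewrite -[m2](submK le12) e0 add0m.
rewrite negb_forall => /existsP[i]; rewrite -ltnNge => lt.
by rewrite (bigD1 i) //= ffact_small // mul0n mul0r.
Qed.

(** The ideal is the annihilator of a module generated by one element, so
membership is tested against [Delta] alone. *)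
Lemma in_J n k (f : {mpoly rat[n + n]}) :
  (forall m, pairing ('X_[m] * f) (Delta n k) = 0) -> f \in J n k.
Proof.
move=> f0; apply/asboolP=> _ [s ->]; rewrite pairing_sumr big1 // => a _.
by rewrite pairing_mderivm f0 mulr0.
Qed.

Lemma J_pairing n k (f : {mpoly rat[n + n]}) (m : 'X_{1..n + n}) :
  f \in J n k -> pairing ('X_[m] * f) (Delta n k) = 0.
Proof.
move/asboolP=> /(_ (mderivm m (Delta n k))); rewrite pairing_mderivm; apply.
by exists [:: (1, m)]; rewrite big_seq1 scale1r.
Qed.

(** * The determinant as a sum over labelled hooks *)

(** The two alphabets are indexed by a boolean, [true] standing for y, so that
statements symmetric in x and y are proved once. *)
Definition idx (n : nat) (s : bool) (i : 'I_n) : 'I_(n + n) :=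
  if s then rshift n i else lshift n i.
Arguments idx : simpl never.

Lemma idxP n (v : 'I_(n + n)) : exists s i, v = idx s i.
Proof.
case: (splitP v) => i e; [exists false | exists true]; exists i;
  by apply/val_inj.
Qed.

Lemma idx_eq n s s' (i i' : 'I_n) :
  (idx s i == idx s' i') = (s == s') && (i == i').
Proof.
have [ltn ltn'] := (ltn_ord i, ltn_ord i').
by case: s s' => [] []; rewrite /idx -!val_eqE /=; lia.
Qed.

Lemma big_idx (R : Type) (z : R) (op : Monoid.com_law z) n s
    (F : 'I_(n + n) -> R) :
  \big[op/z]_v F v =
  op (\big[op/z]_(i < n) F (idx s i)) (\big[op/z]_(i < n) F (idx (~~ s) i)).
Proof. by rewrite big_split_ord; case: s => //=; rewrite Monoid.mulmC. Qed.

Lemma mnm_idxP n (m1 m2 : 'X_{1..n + n}) :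
  (forall s i, m1 (idx s i) = m2 (idx s i)) -> m1 = m2.
Proof. by move=> e; apply/mnmP=> v; have [s [i ->]] := idxP v. Qed.

(** Column [j] of the determinant is the cell of the hook with exponents
[cell n k false j] in x and [cell n k true j] in y. *)
Definition cell (n k : nat) (s : bool) (j : nat) : nat :=
  if (j <= n - k)%N then (if s then j else 0)%N
  else (if s then 0 else j - (n - k))%N.

Definition delta_mon (n k : nat) (t : 'S_n) : 'X_{1..n + n} :=
  [multinom match split v with
            | inl i => cell n k false (t i)
            | inr i => cell n k true (t i)
            end | v < n + n].

Lemma delta_monE n k (t : 'S_n) s i :
  delta_mon k t (idx s i) = cell n k s (t i).
Proof.
rewrite mnmE /idx; case: s => /=.
  by rewrite -[rshift n i]/(unsplit (inr i)) unsplitK.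
by rewrite -[lshift n i]/(unsplit (inl i)) unsplitK.
Qed.

Lemma DeltaE n k :
  Delta n k = \sum_(t : 'S_n) (-1) ^+ t *: 'X_[delta_mon k t].
Proof.
rewrite /Delta /determinant; apply: eq_bigr => t _; rewrite -mul_mpolyC rmorphXn rmorphN1.
congr (_ * _); rewrite mpolyXE_id (big_idx _ false) -big_split /=.
apply: eq_bigr => i _; rewrite mxE !delta_monE /cell.
by case: ifP => _; rewrite expr0 ?mul1r ?mulr1.
Qed.

Lemma cell_inj n k i j : (forall s, cell n k s i = cell n k s j) -> i = j.
Proof.
move=> e; have := e true; have := e false; rewrite /cell.
by case: leqP => ?; case: leqP => ? /=; lia. Qed.

(** A derivative of a column is thus a multiple of another column. *)
Lemma cell_lower n k s (j : 'I_n) : (0 < cell n k s j)%N ->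
  exists j' : 'I_n, cell n k s j = (cell n k s j').+1 /\
                    cell n k (~~ s) j' = cell n k (~~ s) j.
Proof.
have ltn := ltn_ord j; rewrite {1}/cell; case: (leqP j (n - k)) => cj; case: s => // pos.
  have cn : (j.-1 < n)%N by lia.
  exists (Ordinal cn); rewrite /cell /= cj.
  by have -> : (j.-1 <= n - k)%N by [lia]; split; lia.
have cn : ((if j.-1 <= n - k then 0 else j.-1) < n)%N by case: ifP => _; lia.
have cj' : (j <= n - k)%N = false by lia.
exists (Ordinal cn); rewrite /cell /= cj'.
by case: (leqP j.-1 (n - k)) => c' //=; rewrite ?(leqNgt j.-1) ?c' /=; split; lia.
Qed.

(** The contribution to the pairing with [Delta] of a variable pair with
exponents [a], [b] placed in column [j]; the pairing of a monomial is thus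
the determinant of a matrix of rationals. *)
Definition cell_weight (n k : nat) (s : bool) (j a b : nat) : rat :=
  (((a == cell n k s j) && (b == cell n k (~~ s) j)) * (a`! * b`!))%:R.

Lemma pairing_Delta n k s (m : 'X_{1..n + n}) :
  pairing 'X_[m] (Delta n k) =
  \sum_(t : 'S_n) (-1) ^+ t *
    \prod_i cell_weight n k s (t i) (m (idx s i)) (m (idx (~~ s) i)).
Proof.
rewrite DeltaE pairing_sumr; apply: eq_bigr => t _; congr (_ * _).
rewrite pairing_mon -rmorph_prod /= big_split /=; congr _%:R.
rewrite (big_idx _ s) big_split /=; congr (_ * _)%N.
have -> : (m == delta_mon k t) = \big[andb/true]_i
  ((m (idx s i) == cell n k s (t i)) &&
   (m (idx (~~ s) i) == cell n k (~~ s) (t i))).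
  rewrite big_andE; apply/eqP/forallP => [-> i|e]; first by rewrite !delta_monE !eqxx.
  apply: mnm_idxP => s' i; rewrite delta_monE.
  have /andP[/eqP e1 /eqP e2] := e i.
  by case: (s =P s') => [<- //|]; case: s s' e1 e2 {e} => [] [].
by elim/big_rec2: _ => //= i b c _ <-; rewrite -[RHS]/(_ * _)%N mulnb.
Qed.

(** * Elements of the ideal *)

Definition xset (n : nat) (s : bool) (S : {set 'I_n}) : 'X_{1..n + n} :=
  (\sum_(i in S) U_(idx s i))%MM.

Lemma xsetE n s (S : {set 'I_n}) s' i :
  xset s S (idx s' i) = (s == s') && (i \in S).
Proof.
rewrite mnm_sumE; case: (boolP (i \in S)) => [iS|niS].
  rewrite (bigD1 i) //= mnm1E idx_eq eqxx !andbT big1 ?addn0 // => j /andP[_ /negPf ji].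
  by rewrite mnm1E idx_eq ji andbF.
rewrite big1 ?andbF // => j jS; rewrite mnm1E idx_eq.
by case: (j =P i) => [e|_]; rewrite ?andbF //; rewrite e (negPf niS) in jS.
Qed.

(** Differentiating the columns in a nonempty set [T] kills the determinant:
a column of [T] with least exponent either vanishes or becomes proportional to
a column outside [T]. *)
Lemma lowered_columns_det0 n k s (a b : 'I_n -> nat) (T : {set 'I_n}) :
  (0 < #|T|)%N ->
  \det (\matrix_(i, j) cell_weight n k s j (a i + (j \in T)) (b i)) = 0.
Proof.
move=> /card_gt0P[j0 j0T].
have [j jT jmin] : exists2 j, j \in T &
    forall j', j' \in T -> (cell n k s j <= cell n k s j')%N.
  by have [j] := arg_minnP (fun j : 'I_n => cell n k s j) j0T; exists j.
(* A vector in the kernel of the transpose expresses the linear relation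
   between columns: the column itself, or its difference with a multiple of
   the lowered column. *)
rewrite -det_tr; apply/eqP/det0P.
case: (posnP (cell n k s j)) => [e0|pos].
  exists (delta_mx 0 j); first by apply/eqP=> /rowP/(_ j)/eqP; rewrite !mxE !eqxx oner_eq0.
  apply/rowP=> i; rewrite -rowE !mxE jT addn1 /cell_weight e0 /=.
  by rewrite mul0n.
have [j' [e1 e2]] := cell_lower pos.
have j'T : (j' \in T) = false.
  by apply/negP=> /jmin; rewrite e1 ltnn.
exists (delta_mx 0 j - (cell n k s j)%:R *: delta_mx 0 j').
  apply/eqP=> /rowP/(_ j)/eqP; rewrite !mxE !eqxx.
  by case: (j =P j') => [e|_]; rewrite ?mulr0 ?subr0 ?oner_eq0 //; rewrite -e jT in j'T.
apply/rowP=> i; rewrite mulmxBl -scalemxAl -!rowE !mxE jT j'T addn1 addn0.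
rewrite /cell_weight e2 {1}e1 eqSS; case: (a i =P _) => [ea|_] /=.
  case: (_ == _); rewrite ?mul0n ?mulr0 ?subr0 // !mul1n ea factS e1.
  by rewrite !natrM mulrA subrr.
by rewrite !mul0n mulr0 subr0.
Qed.

(** An elementary symmetric polynomial of positive degree in one alphabet
annihilates [Delta]; it is multiplied here by a monomial, the form in which
straightening uses it. Exchanging sets of rows with sets of columns turns the
pairing into a sum of vanishing determinants. *)
Lemma esym_in_J n k s r (m : 'X_{1..n + n}) : (0 < r)%N ->
  \sum_(S : {set 'I_n} | #|S| == r) 'X_[m + xset s S] \in J n k.
Proof.
move=> r0; apply: in_J => m'.
rewrite mulr_sumr pairing_suml.
pose a i := (m (idx s i) + m' (idx s i))%N.
pose b i := (m (idx (~~ s) i) + m' (idx (~~ s) i))%N.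
transitivity (\sum_(T : {set 'I_n} | #|T| == r)
  \det (\matrix_(i, j) cell_weight n k s j (a i + (j \in T)) (b i))); last first.
  by rewrite big1 // => T /eqP eT; apply: lowered_columns_det0; rewrite eT.
under eq_bigr => S _ do rewrite -mpolyXD (pairing_Delta _ s).
rewrite exchange_big [RHS]exchange_big /=; apply: eq_bigr => t _.
rewrite -!mulr_sumr; congr (_ * _).
rewrite [RHS](reindex_inj (imset_inj (@perm_inj _ t))) /=.
apply: eq_big => [S|S _]; first by rewrite card_imset //; apply: perm_inj.
apply: eq_bigr => i _; rewrite mxE (mem_imset _ _ (@perm_inj _ t)).
rewrite !mnmDE !xsetE eqxx /a /b; congr cell_weight; last first.
  by have -> : (s == ~~ s) = false by [case: (s)]; rewrite addn0 addnC.
by rewrite /= addnA [(m' _ + _)%N]addnC.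
Qed.

Lemma mon_notin_J n k (m : 'X_{1..n + n}) : 'X_[m] \notin J n k ->
  exists t : 'S_n, (m <= delta_mon k t)%MM.
Proof.
move=> mJ; apply/existsP; apply: contraR mJ => /existsPn no; apply: in_J => m'.
rewrite -mpolyXD DeltaE pairing_sumr big1 // => t _.
rewrite pairing_mon; case: eqP => [e|_]; last by rewrite mul0n mulr0.
by case/negP: (no t); rewrite -e lem_addl.
Qed.

(** * Integer keys sorted by permutations *)

Lemma decreasing_consecutive n (g : 'I_n -> int) :
  (forall i j : 'I_n, j = i.+1 :> nat -> g j < g i) ->
  forall i j : 'I_n, (i < j)%N -> g j < g i.
Proof.
move=> gS i [j ltj]; elim: j ltj => // j IH ltj; rewrite /= ltnS leq_eqVlt.
case/predU1P => [e|ltij]; first by apply: gS; rewrite /= e.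
by apply: lt_trans (IH (ltnW ltj) ltij); apply: gS.
Qed.

Lemma eq_consecutive n (f g : 'I_n -> int) (q : 'I_n) : f q = g q ->
  (forall i j : 'I_n, j = i.+1 :> nat -> f i - f j = g i - g j) -> f =1 g.
Proof.
move=> fgq fgS; have n0 : (0 < n)%N by apply: leq_ltn_trans (ltn_ord q).
have const i : f i - g i = f (Ordinal n0) - g (Ordinal n0).
  case: i => i lti; elim: i lti => [|i IH] lti; first by congr (f _ - g _); apply/val_inj.
  have := fgS (Ordinal (ltnW lti)) (Ordinal lti) erefl.
  by have := IH (ltnW lti); lia.
by move=> i; have := const i; have := const q; lia.
Qed.

Definition sorts (n : nat) (p : 'S_n) (f : 'I_n -> int) : Prop :=
  forall i j : 'I_n, (i < j)%N -> f (p j) < f (p i).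

Lemma sorting_perm n (f : 'I_n -> int) : injective f -> exists p, sorts p f.
Proof.
move=> f_inj; pose above i := [set v | f i < f v].
have ltn i : (#|above i| < n)%N.
  rewrite -[X in (_ < X)%N]card_ord -cardsT; apply: proper_card.
  by apply/properP; split; [apply: subsetT | exists i; rewrite inE ?ltxx].
have above_lt i j : f i < f j -> (#|above j| < #|above i|)%N.
  move=> ltij; apply: proper_card; apply/properP; split.
    by apply/subsetP=> v; rewrite !inE; apply: lt_trans.
  by exists j; rewrite inE ?ltxx.
have rank_inj : injective (fun i => Ordinal (ltn i)).
  move=> i j /(congr1 val) /= e; apply: f_inj.
  by case: (ltgtP (f i) (f j)) => // /above_lt; rewrite e ltnn.
exists (perm rank_inj)^-1%g => i j; rewrite -{1}[i](permKV (perm rank_inj)).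
rewrite -{1}[j](permKV (perm rank_inj)) !permE /= => lt.
rewrite ltNge; apply/negP; rewrite le_eqVlt => /predU1P[/f_inj e|/above_lt].
  by rewrite e ltnn in lt.
by move=> lt'; have := ltn_trans lt lt'; rewrite ltnn.
Qed.

(** Exchanging [S :\: P] for [P :\: S], which has the same size, replaces keys
below the least key of [P :\: S] by keys at least as large as it. *)
Lemma topset_sum (T : finType) (f : T -> int) (P S : {set T}) :
  #|S| = #|P| -> (forall u v, u \in P -> v \notin P -> f v < f u) ->
  S != P -> \sum_(i in S) f i < \sum_(i in P) f i.
Proof.
move=> eSP top neSP; rewrite (big_setID P) [ltRHS](big_setID S) /= setIC ltrD2l.
have cD : #|S :\: P| = #|P :\: S| by rewrite !cardsD eSP setIC.
have /card_gt0P[u0 u0PS] : (0 < #|P :\: S|)%N.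
  rewrite lt0n cards_eq0; apply: contra neSP => /eqP e.
  by rewrite eq_sym eqEcard eSP leqnn andbT -setD_eq0 e.
have [u uPS umin] : exists2 u, u \in P :\: S &
    forall v, v \in P :\: S -> f u <= f v.
  by case: (arg_minP f u0PS) => u; exists u.
apply: (@lt_le_trans _ _ (\sum_(i in P :\: S) f u)); last exact: ler_sum.
rewrite sumr_const -cD -sumr_const; apply: ltr_sum.
  have /card_gt0P[v vSP] : (0 < #|S :\: P|)%N by rewrite cD; apply/card_gt0P; exists u.
  by apply/hasP; exists v; rewrite ?mem_index_enum.
move=> v; rewrite inE => /andP[vP _].
by apply: top => //; move: uPS; rewrite inE => /andP[].
Qed.

Lemma card_ord_lt n c : (c <= n)%N -> #|[set j : 'I_n | (j < c)%N]| = c.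
Proof.
move=> le; rewrite -sum1_card -[RHS]card_ord -sum1_card.
by rewrite (big_ord_widen n (fun=> 1%N) le); apply: eq_bigl => j; rewrite inE.
Qed.

Lemma sum_weighted n (f : 'I_n -> int) :
  \sum_(j < n) j%:Z * f j = \sum_(i < n) \sum_(j : 'I_n | (i < j)%N) f j.
Proof.
rewrite (exchange_big_dep xpredT) //=; apply: eq_bigr => j _.
rewrite sumr_const -mulr_natl natz; congr (_%:Z * _).
by rewrite -[LHS](card_ord_lt (ltnW (ltn_ord j))) cardsE.
Qed.

(** The weighted sum is a sum over final segments of positions, and on each
segment the extremal property of top sets applies, with signs reversed. *)
Lemma rearrangement n (f : 'I_n -> int) (p r : 'S_n) : sorts p f -> r != p ->
  \sum_(j < n) j%:Z * f (p j) < \sum_(j < n) j%:Z * f (r j).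
Proof.
move=> psort nerp; rewrite !sum_weighted.
pose U (i : 'I_n) := [set j : 'I_n | (i < j)%N].
have sumU (r' : 'S_n) (i : 'I_n) :
    \sum_(j : 'I_n | (i < j)%N) f (r' j) = - \sum_(v in r' @: U i) - f v.
  rewrite big_imset /=; last by move=> x y _ _; apply: perm_inj.
  by rewrite sumrN opprK; apply: eq_bigl => j; rewrite inE.
have ltU (i : 'I_n) : r @: U i != p @: U i ->
    \sum_(j : 'I_n | (i < j)%N) f (p j) < \sum_(j : 'I_n | (i < j)%N) f (r j).
  move=> ne; rewrite !sumU ltrN2; apply: topset_sum => //.
    by rewrite !card_imset //; apply: perm_inj.
  move=> _ v /imsetP[j jU ->]; rewrite -[v](permKV p) mem_imset; last exact: perm_inj.
  rewrite ltrN2 inE -leqNgt => le; apply: psort; apply: leq_ltn_trans le _.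
  by rewrite inE in jU.
have leU (i : 'I_n) : \sum_(j : 'I_n | (i < j)%N) f (p j) <= \sum_(j : 'I_n | (i < j)%N) f (r j).
  by case: (eqVneq (r @: U i) (p @: U i)) => [e|/ltU/ltW //]; rewrite !sumU e.
have [i nei] : exists i, r @: U i != p @: U i.
  apply/existsP; apply: contraR nerp => /existsPn eqU; apply/eqP/permP=> j.
  (* The final segments of [p] and [r] agree, so each index sits at the same
     position in both. *)
  have same (i : 'I_n) : (i < j)%N = (i < (p^-1)%g (r j))%N.
    have /negPn/eqP/setP/(_ (r j)) := eqU i.
    rewrite -{2}[r j](permKV p) !mem_imset; [|exact: perm_inj..].
    by rewrite !inE.
  rewrite -[LHS](permKV p); congr (p _); apply/val_inj => /=.
  by have := same j; have := same ((p^-1)%g (r j)); rewrite !ltnn; lia.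
by rewrite (bigD1 i) //= [ltRHS](bigD1 i) //=; apply: ltr_leD; [apply: ltU | apply: ler_sum].
Qed.

(** * Signed exponents *)

(** When no index carries both an x and a y, a monomial is determined by its
signed exponents: x-exponent minus y-exponent. *)
Definition zexp (n : nat) (m : 'X_{1..n + n}) (i : 'I_n) : int :=
  (m (idx false i))%:Z - (m (idx true i))%:Z.

Definition separated (n : nat) (m : 'X_{1..n + n}) : Prop :=
  forall i, m (idx false i) = 0%N \/ m (idx true i) = 0%N.

Lemma zexp_inj n (m1 m2 : 'X_{1..n + n}) :
  separated m1 -> separated m2 -> zexp m1 =1 zexp m2 -> m1 = m2.
Proof.
move=> s1 s2 ez; apply: mnm_idxP => s i; have := ez i; rewrite /zexp.
by case: (s1 i) (s2 i) => [] e1 [] e2; case: s; lia.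
Qed.

Lemma zexpD n (m1 m2 : 'X_{1..n + n}) i :
  zexp (m1 + m2)%MM i = zexp m1 i + zexp m2 i.
Proof. by rewrite /zexp !mnmDE !PoszD; lia. Qed.

Lemma zexp_xset n s (S : {set 'I_n}) i :
  zexp (xset s S) i = (-1) ^+ s * (i \in S)%:Z.
Proof. by rewrite /zexp !xsetE; case: s (i \in S) => [] []. Qed.

Lemma cell_separated n k (t : 'S_n) : separated (delta_mon k t).
Proof. by move=> i; rewrite !delta_monE /cell; case: ifP; [left | right]. Qed.

Lemma separated_le n (m m' : 'X_{1..n + n}) :
  (m <= m')%MM -> separated m' -> separated m.
Proof.
move=> /mnm_lepP le s i.
by case: (s i) => e; [left | right]; apply/eqP; rewrite -leqn0 -e.
Qed.

(** The signed exponent, with ties broken by the index: smaller indices get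
larger keys, and distinct indices get distinct keys. *)
Definition key (n : nat) (m : 'X_{1..n + n}) (i : 'I_n) : int :=
  n%:Z * zexp m i - i%:Z.

(** Indices differ by less than [n], so keys compare like two-digit numbers. *)
Lemma key_lt n (m : 'X_{1..n + n}) (i j : 'I_n) : key m j < key m i ->
  (j < i)%N%:Z <= zexp m i - zexp m j.
Proof.
rewrite /key; have := ltn_ord i; have := ltn_ord j; set a := zexp m i; set b := zexp m j.
move: (nat_of_ord i) (nat_of_ord j) => x y ltj lti lt.
have lt' : x%:Z - y%:Z < n%:Z * (a - b) by lia.
move: lt' {lt}; move: (a - b) => c {a b}.
have [c0|c0] := lerP 0 c; last by nia.
have [->|c1] := eqVneq c 0; last by lia.
by rewrite mulr0; lia.
Qed.

Lemma key_inj n (m : 'X_{1..n + n}) : injective (key m).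
Proof.
move=> i j; rewrite /key => e; apply/val_inj; have := ltn_ord i; have := ltn_ord j.
move=> /= ltj lti; have : n%:Z * (zexp m i - zexp m j) = i%:Z - j%:Z by lia.
by case: (ltgtP (zexp m i) (zexp m j)) => h; nia.
Qed.

(** A drop in signed exponent larger than the tie-break requires leaves the keys
in order even after one unit is removed from the larger one. *)
Lemma key_gap n (m : 'X_{1..n + n}) (i j : 'I_n) : i != j ->
  (j < i)%N%:Z < zexp m i - zexp m j -> key m j + n%:Z < key m i.
Proof.
rewrite /key -val_eqE /=; have := ltn_ord i; have := ltn_ord j.
set a := zexp m i; set b := zexp m j.
move: (nat_of_ord i) (nat_of_ord j) => x y ltj lti ne lt.
have mono (c : int) : c <= a - b -> n%:Z * c <= n%:Z * a - n%:Z * b.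
  by rewrite -mulrBr; apply: ler_wpM2l.
have [yx|yx|e] := ltngtP x y; last by rewrite e eqxx in ne.
  have /mono : 1 <= a - b by lia.
  by lia.
have /mono : 2 <= a - b by lia.
by lia.
Qed.

(** * Monomials attached to a permutation and a set of positions *)

(** The indices whose variables are multiplied when cutting at position [d]:
an initial segment of [p], for x, or a final one, for y. Counting positions
from 0, the signed exponents change sign at the pivot [k - 1], which lies in
none of these segments. The complement of a descent set contains the last
position, whose segment is empty. *)
Definition segment (n k : nat) (p : 'S_n) (d : 'I_n) : {set 'I_n} :=
  p @: [set j : 'I_n | if (k <= d.+1)%N then (d < j)%N else (j <= d)%N].

Definition segment_mon (n k : nat) (p : 'S_n) (E : {set 'I_n}) : 'X_{1..n + n} :=
  (\sum_(d in E) xset (k <= d.+1)%N (segment k p d))%MM.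

Lemma mem_segment n k (p : 'S_n) (d j : 'I_n) :
  (p j \in segment k p d) = (if (k <= d.+1)%N then (d < j)%N else (j <= d)%N).
Proof. by rewrite mem_imset ?inE //; apply: perm_inj. Qed.

Lemma mpolyX_xset n s (p : 'S_n) (P : pred 'I_n) :
  'X_[xset s (p @: [set j | P j])] = \prod_(j < n | P j) 'X_(idx s (p j))
  :> {mpoly rat[n + n]}.
Proof.
rewrite /xset big_imset /=; last by move=> x y _ _; apply: perm_inj.
by rewrite mprodXE; congr 'X_[_]; apply: eq_bigl => j; rewrite inE.
Qed.

Lemma descent_monomialE n k (p : 'S_n) : (1 <= k)%N ->
  descent_monomial k p = 'X_[segment_mon k p (Des p)].
Proof.
move=> k1; rewrite -mprodXE (bigID (fun d : 'I_n => (k <= d.+1)%N)) /= mulrC.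
congr (_ * _); apply: eq_big => [d|d /andP[_ hd]].
- by congr (_ && _); lia.
- have hd' : (k <= d.+1)%N = false by lia.
  by rewrite /segment hd' (mpolyX_xset false).
- by [].
- by rewrite /segment hd (mpolyX_xset true).
Qed.

Lemma segment_monU n k (p : 'S_n) (E : {set 'I_n}) :
  (segment_mon k p E + segment_mon k p (~: E))%MM = segment_mon k p setT.
Proof.
rewrite /segment_mon [RHS](bigID (mem E)) /=.
by congr (_ + _)%MM; apply: eq_bigl => d; rewrite !inE.
Qed.

Lemma segment_mon_gt0 n k (p : 'S_n) E s (j : 'I_n) :
  (0 < segment_mon k p E (idx s (p j)))%N ->
  if s then (k <= j)%N else (j.+1 < k)%N.
Proof.
rewrite mnm_sumE lt0n sum_nat_eq0 negb_forall => /existsP[d].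
rewrite negb_imply xsetE mem_segment eqb0 negbK => /andP[_ /andP[/eqP <-]].
by case: ifP => hd h; lia.
Qed.

Lemma segment_mon_separated n k (p : 'S_n) E : separated (segment_mon k p E).
Proof.
move=> i; rewrite -[i](permKV p); set j := (p^-1)%g i.
case: (posnP (segment_mon k p E (idx false (p j)))) => [|/segment_mon_gt0 /= h1]; first by left.
case: (posnP (segment_mon k p E (idx true (p j)))) => [|/segment_mon_gt0 /= h2]; first by right.
by lia.
Qed.

Lemma zexp_segment_mon n k (p : 'S_n) E (i : 'I_n) :
  zexp (segment_mon k p E) i =
  \sum_(d in E) (-1) ^+ (k <= d.+1)%N * (i \in segment k p d)%:Z.
Proof.
rewrite /segment_mon; elim/big_rec2: _ => [|d y m _ <-].
  by rewrite /zexp !mnm0E.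
by rewrite zexpD zexp_xset.
Qed.

(** Whichever alphabet it uses, a cut after position [i] lowers the signed
exponent by one between [i] and [i + 1] and nowhere else. *)
Lemma segment_mon_step n k (p : 'S_n) E (i j : 'I_n) : j = i.+1 :> nat ->
  zexp (segment_mon k p E) (p i) - zexp (segment_mon k p E) (p j) = (i \in E)%:Z.
Proof.
move=> ji; rewrite !zexp_segment_mon -sumrB.
rewrite (eq_bigr (fun d => (d == i)%:Z)) => [|d _].
  case: (boolP (i \in E)) => iE.
    by rewrite (bigD1 i) //= eqxx big1 ?addr0 // => d /andP[_ /negPf ->].
  by rewrite big1 // => d dE; case: eqP => // e; rewrite -e dE in iE.
rewrite !mem_segment ji -val_eqE /=.
by case: ifP => _; case: (ltngtP d i) => h;
  rewrite ?ltnS ?expr0 ?expr1; lia.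
Qed.

Lemma segment_mon_pivot n k (p : 'S_n) E (q : 'I_n) : q.+1 = k ->
  zexp (segment_mon k p E) (p q) = 0.
Proof.
move=> qk; rewrite zexp_segment_mon big1 // => d _; rewrite mem_segment.
suff -> : (if (k <= d.+1)%N then (d < q)%N else (q <= d)%N) = false by rewrite mulr0.
by case: ifP => h; lia.
Qed.

Lemma in_Des n (p : 'S_n) (i j : 'I_n) : j = i.+1 :> nat ->
  (i \in Des p) = (p j < p i)%N.
Proof.
move=> ji; rewrite inE; apply/existsP/idP => [[j' /andP[/eqP e lt]]|lt].
  by have -> : j = j' by apply/val_inj; rewrite /= ji e.
by exists j; rewrite ji eqxx.
Qed.

(** * Spanning: straightening *)

Definition spanned (n k : nat) (f : {mpoly rat[n + n]}) : Prop :=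
  exists c : 'S_n -> rat,
    proj k f = \sum_p c p *: proj k (descent_monomial k p).

Lemma spannedD n k (f g : {mpoly rat[n + n]}) c :
  spanned k f -> spanned k g -> spanned k (c *: f + g).
Proof.
move=> [a ea] [b eb]; exists (fun p => c * a p + b p).
rewrite linearP /= ea eb scaler_sumr -big_split /=.
by apply: eq_bigr => p _; rewrite scalerDl scalerA.
Qed.

Lemma spanned_J n k (f : {mpoly rat[n + n]}) : f \in J n k -> spanned k f.
Proof.
move=> Jf; exists (fun=> 0); rewrite big1 => [|p _]; last by rewrite scale0r.
by rewrite -(linear0 (proj k)); apply/proj_eq; rewrite subr0.
Qed.

Lemma spanned_sum n k (I : Type) (r : seq I) (P : pred I)
    (F : I -> {mpoly rat[n + n]}) :
  (forall i, P i -> spanned k (F i)) -> spanned k (\sum_(i <- r | P i) F i).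
Proof.
move=> sF; elim/big_rec: _ => [|i f Pi IH].
  by apply: spanned_J; have [] := J_submod n k.
by rewrite -[F i]scale1r; apply: spannedD => //; apply: sF.
Qed.

(** The measure of the straightening: by convexity, multiplying by [xset s S]
raises it most when [S] carries the keys that are already extreme. *)
Definition potential (n : nat) (m : 'X_{1..n + n}) : nat :=
  absz (\sum_(i < n) key m i ^+ 2).

Lemma potential_lt n (s : bool) (m : 'X_{1..n + n}) (S0 S : {set 'I_n}) :
  #|S| = #|S0| -> S != S0 ->
  (forall u v, u \in S0 -> v \notin S0 ->
     (-1) ^+ s * key m v < (-1) ^+ s * key m u) ->
  (potential (m + xset s S) < potential (m + xset s S0))%N.
Proof.
move=> eS neS top.
have n0 : (0 < n)%N.
  rewrite lt0n; apply: contra neS => /eqP en; apply/eqP/setP=> i.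
  by case: i => i lti; exfalso; rewrite en in lti.
(* Only the cross term depends on more than the size of [S']. *)
have expand (S' : {set 'I_n}) : \sum_(i < n) key (m + xset s S') i ^+ 2 =
    \sum_(i < n) key m i ^+ 2 + n%:Z ^+ 2 *+ #|S'|
    + (n%:Z *+ 2) * \sum_(i in S') (-1) ^+ s * key m i.
  rewrite mulr_sumr -sumr_const ![\sum_(i in S') _]big_mkcond -!big_split /=.
  apply: eq_bigr => i _; rewrite /key zexpD zexp_xset.
  by case: (i \in S'); case: s {top} => /=; rewrite ?expr0 ?expr1; nia.
rewrite -ltz_nat /potential !gez0_abs ?sumr_ge0 // => [|i _|i _]; rewrite ?sqr_ge0 //.
rewrite !expand eS ltrD2l ltr_pM2l; last by rewrite pmulrn_lgt0 // ltz_nat.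
exact: topset_sum.
Qed.

(** Modulo the ideal, [xset s S0] is minus the sum of the other squarefree
products of the same degree, and these lower the potential. *)
Lemma spanned_step n k (s : bool) (m : 'X_{1..n + n}) (S0 : {set 'I_n}) :
  (0 < #|S0|)%N ->
  (forall u v, u \in S0 -> v \notin S0 ->
     (-1) ^+ s * key m v < (-1) ^+ s * key m u) ->
  (forall m', (potential m' < potential (m + xset s S0))%N ->
     @spanned n k 'X_[m']) ->
  @spanned n k 'X_[m + xset s S0].
Proof.
move=> S0n top IH; have := esym_in_J k s m S0n.
rewrite (bigD1 S0) //= => /spanned_J sp.
set f := 'X_[_] in sp *; set g := \sum_(_ | _) _ in sp.
have -> : f = -1 *: g + (f + g) by rewrite scaleN1r addrC addrK.
apply: spannedD => //; apply: spanned_sum => S /andP[/eqP eS neS].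
by apply: IH; apply: potential_lt.
Qed.

(** A monomial outside the ideal divides a monomial of [Delta], so it involves
at most [k - 1] of the x and at most [n - k] of the y. Sorting its signed
exponents therefore puts a zero at the pivot. *)
Lemma pivot_zexp n k (m : 'X_{1..n + n}) (p : 'S_n) (q : 'I_n) : q.+1 = k ->
  'X_[m] \notin J n k ->
  (forall i j : 'I_n, (i <= j)%N -> zexp m (p j) <= zexp m (p i)) ->
  zexp m (p q) = 0.
Proof.
move=> qk /mon_notin_J[t /mnm_lepP le] dec; have ltq := ltn_ord q.
have le_cell s i : (m (idx s i) <= cell n k s (t i))%N by rewrite -delta_monE.
have tp_inj : injective (fun j => t (p j)) by move=> i j /perm_inj/perm_inj.
case: (ltgtP (zexp m (p q)) 0) => // sgn.
- have [c0 c0E] : exists c : 'I_n, c = 0%N :> nat.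
    by exists (Ordinal (leq_ltn_trans (leq0n q) ltq)).
  pose A := [set j : 'I_n | (j < (n - k).+1)%N].
  have : ((fun j => t (p j)) @: (~: [set j : 'I_n | (j < q)%N]) \subset A :\ c0).
    apply/subsetP=> _ /imsetP[j jS ->]; move: jS; rewrite !inE -leqNgt => qj.
    have := le_lt_trans (dec _ _ qj) sgn; have := le_cell true (p j).
    by rewrite /zexp /cell -val_eqE /= c0E ltnS; case: (leqP (t (p j)) (n - k)) => h; lia.
  have eA : #|A :\ c0| = (n - k)%N.
    apply/eqP; rewrite -eqSS -add1n -(card_ord_lt (_ : (n - k).+1 <= n)%N); last by lia.
    by rewrite [eqbRHS](cardsD1 c0) inE c0E.
  move/subset_leq_card/leq_trans/(_ (eq_leq eA)).
  rewrite (card_imset _ tp_inj) cardsCs setCK card_ord (card_ord_lt (ltnW ltq)).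
  by lia.
- have : ((fun j => t (p j)) @: [set j : 'I_n | (j < q.+1)%N] \subset
          ~: [set j : 'I_n | (j < (n - k).+1)%N]).
    apply/subsetP=> _ /imsetP[j jS ->]; move: jS; rewrite !inE ltnS => jq.
    have := lt_le_trans sgn (dec _ _ jq); have := le_cell false (p j).
    by rewrite /zexp /cell ltnS; case: (leqP (t (p j)) (n - k)) => h; lia.
  move/subset_leq_card; rewrite (card_imset _ tp_inj) [leqRHS]cardsCs setCK card_ord.
  by rewrite !card_ord_lt; lia.
Qed.

(** If the signed exponents of a sorted monomial drop somewhere by more than
the descent there requires, a whole segment can be split off and straightened;
otherwise the monomial is the descent monomial of its sorting permutation. *)
Lemma spanned_mon n k (hk : (1 <= k)%N) (hkn : (k <= n)%N) (m : 'X_{1..n + n}) :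
  @spanned n k 'X_[m].
Proof.
have [w] := ubnP (potential m); elim: w m => // w IH m /ltnSE le_w.
have [|mJ] := boolP ('X_[m] \in J n k); first exact: spanned_J.
have [p psort] := sorting_perm (@key_inj n m).
have dec (i j : 'I_n) : (i <= j)%N -> zexp m (p j) <= zexp m (p i).
  by rewrite leq_eqVlt => /predU1P[/val_inj -> //|/psort/key_lt]; lia.
have [q qk] : exists q : 'I_n, q.+1 = k.
  have kn : (k.-1 < n)%N by lia.
  by exists (Ordinal kn); rewrite /= prednK.
have q0 := pivot_zexp qk mJ dec.
have drop (i j : 'I_n) : j = i.+1 :> nat ->
    (i \in Des p)%:Z <= zexp m (p i) - zexp m (p j).
  by move=> ji; rewrite (in_Des p ji); apply: key_lt; apply: psort; rewrite ji.
have [/existsP[d /existsP[d' /andP[/eqP d'd big]]]|none] :=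
  boolP [exists d : 'I_n, exists d' : 'I_n, (d' == d.+1 :> nat) &&
    ((d \in Des p)%:Z < zexp m (p d) - zexp m (p d'))]; last first.
  (* All drops are the prescribed ones, and the value at the pivot is 0. *)
  have -> : m = segment_mon k p (Des p).
    have [t le] := mon_notin_J mJ.
    apply: zexp_inj (separated_le le (cell_separated k t)) _ _.
      exact: segment_mon_separated.
    move=> i; rewrite -[i](permKV p); move: {i}((p^-1)%g i).
    apply: (@eq_consecutive _ _ _ q); first by rewrite q0 segment_mon_pivot.
    move=> i j ji; rewrite segment_mon_step //; apply/eqP.
    rewrite eq_le (drop _ _ ji) andbT leNgt; apply: contra none => lt.
    by apply/existsP; exists i; apply/existsP; exists j; rewrite ji eqxx.
  rewrite -descent_monomialE //; exists (fun p' => (p' == p)%:R).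
  rewrite (bigD1 p) //= eqxx scale1r big1 ?addr0 // => p' /negPf ->.
  by rewrite scale0r.
(* The drop after [d] is too large: split off the segment cut there. *)
pose s := (k <= d.+1)%N; pose S0 := segment k p d.
have gap : key m (p d') + n%:Z < key m (p d).
  have ne : p d != p d' by apply/eqP=> /perm_inj e; move: d'd; rewrite e; lia.
  by apply: key_gap => //; rewrite -in_Des.
have dvd : (xset s S0 <= m)%MM.
  apply/mnm_lepP=> v; have [s' [i ->]] := idxP v; rewrite xsetE.
  case: eqP => //= <-; rewrite -[i](permKV p); move: {i v s'}((p^-1)%g i) => j.
  rewrite mem_segment -/s; case: (boolP s) => hs; rewrite /s in hs.
    case: (ltnP d j) => // dj.
    have : zexp m (p j) <= zexp m (p d') by apply: dec; rewrite d'd.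
    have : zexp m (p d) <= 0 by rewrite -q0; apply: dec; lia.
    by move: big; rewrite /zexp; lia.
  case: (leqP j d) => // jd.
  have : zexp m (p d) <= zexp m (p j) by apply: dec.
  have : 0 <= zexp m (p d') by rewrite -q0; apply: dec; lia.
  by move: big; rewrite /zexp; lia.
have em : m = (m - xset s S0 + xset s S0)%MM by rewrite submK.
have keyE v : key m v = key (m - xset s S0)%MM v + n%:Z * ((-1) ^+ s * (v \in S0)%:Z).
  by rewrite {1}em /key zexpD zexp_xset mulrDr addrAC.
have mono (i j : 'I_n) : (i <= j)%N -> key m (p j) <= key m (p i).
  by rewrite leq_eqVlt => /predU1P[/val_inj -> //|/psort/ltW].
rewrite em; apply: spanned_step.
- apply/card_gt0P; exists (p (if s then d' else d)).
  by rewrite mem_segment -/s; case: (s); rewrite ?d'd.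
- move=> u v; rewrite -[u](permKV p) -[v](permKV p).
  move: ((p^-1)%g u) ((p^-1)%g v) => i j iS /negPf jS.
  move: (keyE (p i)) (keyE (p j)) gap; rewrite iS jS; move: iS jS.
  move: (key (m - xset s S0)%MM (p i)) (key (m - xset s S0)%MM (p j)) => x y.
  rewrite !mem_segment -/s; case: (s) => hi hj.
    have := mono d' i; have := mono j d.
    by rewrite d'd hi leqNgt hj !expr1 => /(_ isT) h1 /(_ isT) h2; lia.
  have := mono i d; have := mono d' j.
  by rewrite d'd hi ltnNge hj !expr0 => /(_ isT) h1 /(_ isT) h2; lia.
- by rewrite -em => m' lt; apply: IH; apply: leq_trans lt le_w.
Qed.

(** * Independence: triangularity of the pairing *)

(** The columns of [Delta] listed along the hook, from the largest power of x
down to 1 and on to the largest power of y. *)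
Lemma hook_order n k : (1 <= k)%N -> (k <= n)%N ->
  exists c : 'S_n, forall j : 'I_n,
    (cell n k false (c j))%:Z - (cell n k true (c j))%:Z = k.-1%:Z - j%:Z.
Proof.
move=> hk hkn.
pose col (j : 'I_n) := if (k <= j.+1)%N then (j - k.-1)%N else (n - j.+1)%N.
have ltn (j : 'I_n) : (col j < n)%N.
  by have := ltn_ord j; rewrite /col; case: ifP; lia.
have colE (j : 'I_n) : (cell n k false (col j))%:Z - (cell n k true (col j))%:Z
    = k.-1%:Z - j%:Z.
  have := ltn_ord j; rewrite /cell /col; case: (leqP k j.+1) => h ltj.
    by have -> : (j - k.-1 <= n - k)%N by [lia]; lia.
  by have -> : (n - j.+1 <= n - k)%N = false by [lia]; lia.
have col_inj : injective (fun j => Ordinal (ltn j)).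
  move=> i j /(congr1 val) /= e; apply/val_inj => /=.
  by have := colE i; rewrite e colE; lia.
by exists (perm col_inj) => j; rewrite permE /= colE.
Qed.

Lemma zexp_delta_mon n k (t : 'S_n) i :
  zexp (delta_mon k t) i = (cell n k false (t i))%:Z - (cell n k true (t i))%:Z.
Proof. by rewrite /zexp !delta_monE. Qed.

(** With every position cut, the exponents run once through the hook. *)
Lemma zexp_full n k (p : 'S_n) (j : 'I_n) : (1 <= k)%N -> (k <= n)%N ->
  zexp (segment_mon k p setT) (p j) = k.-1%:Z - j%:Z.
Proof.
move=> hk hkn; have kn : (k.-1 < n)%N by lia.
move: j; apply: (@eq_consecutive _ _ _ (Ordinal kn)).
  by rewrite segment_mon_pivot ?subrr //= prednK.
by move=> i j ji; rewrite segment_mon_step // inE ji; lia.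
Qed.

Lemma pairing_full n k (p : 'S_n) : (1 <= k)%N -> (k <= n)%N ->
  pairing 'X_[segment_mon k p setT] (Delta n k) != 0.
Proof.
move=> hk hkn; have [c cE] := hook_order hk hkn.
have delta_inj (t t' : 'S_n) : delta_mon k t = delta_mon k t' -> t = t'.
  move=> e; apply/permP=> i; apply/val_inj/(@cell_inj n k) => s.
  by rewrite -!delta_monE e.
have -> : segment_mon k p setT = delta_mon k (p^-1 * c)%g.
  apply: zexp_inj; [exact: segment_mon_separated | exact: cell_separated |].
  move=> i; rewrite -[i](permKV p) zexp_full // zexp_delta_mon.
  by rewrite permM permK cE.
rewrite DeltaE pairing_sumr (bigD1 (p^-1 * c)%g) //= big1 => [|t' ne]; last first.
  rewrite pairing_mon; case: eqP => [/delta_inj e|_]; last by rewrite mulr0.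
  by rewrite e eqxx in ne.
rewrite addr0 mulf_neq0 ?signr_eq0 // pairing_mon eqxx mul1n pnatr_eq0 -lt0n.
by apply: prodn_gt0 => i; apply: fact_gt0.
Qed.

(** Position-weighted sum of the keys of the descent monomial: the statistic
along which the pairing is triangular. *)
Definition descent_weight (n k : nat) (p : 'S_n) : int :=
  \sum_(j < n) j%:Z * key (segment_mon k p (Des p)) (p j).

(** The signed exponents of the descent monomial are constant across ascents, so
ties are in increasing order of index. *)
Lemma sorts_descent_key n k (p : 'S_n) :
  sorts p (key (segment_mon k p (Des p))).
Proof.
apply: decreasing_consecutive => i j ji.
have := segment_mon_step k p (Des p) ji; rewrite (in_Des p ji) /key.
move=> /(congr1 ( *%R n%:Z)); rewrite mulrBr; have := ltn_ord (p i); have := ltn_ord (p j).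
have ne : p j != p i :> nat by apply: contra_eq_neq ji => /val_inj/perm_inj ->; lia.
by case: (ltnP (p j) (p i)) => h /=; rewrite ?mulr0 ?mulr1; lia.
Qed.

(** The signed exponents of the complementary monomial are constant across
descents, so ties are in decreasing order of index and the tie-break has the
opposite sign. *)
Lemma sorts_ascent_key n k (p : 'S_n) :
  sorts p (fun i => n%:Z * zexp (segment_mon k p (~: Des p)) i + i%:Z).
Proof.
apply: decreasing_consecutive => i j ji.
have := segment_mon_step k p (~: Des p) ji; rewrite inE (in_Des p ji).
move=> /(congr1 ( *%R n%:Z)); rewrite mulrBr; have := ltn_ord (p i); have := ltn_ord (p j).
have ne : p j != p i :> nat by apply: contra_eq_neq ji => /val_inj/perm_inj ->; lia.
by case: (ltnP (p j) (p i)) => h /=; rewrite ?mulr0 ?mulr1; lia.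
Qed.

(** If the product of the descent monomial of [p] and the complementary
monomial of [s] occurs in [Delta], then its signed exponents decrease by one at
each step along a permutation [r]. Comparing [r] with [p] in the first factor
and with [s] in the second by the rearrangement inequality gives the claim. *)
Lemma pairing_triangular n k (p s : 'S_n) : (1 <= k)%N -> (k <= n)%N ->
  pairing 'X_[segment_mon k p (Des p) + segment_mon k s (~: Des s)] (Delta n k)
    != 0 ->
  p != s -> descent_weight k p < descent_weight k s.
Proof.
move=> hk hkn nz neps; have [c cE] := hook_order hk hkn.
set m := (_ + _)%MM in nz *.
have [t /eqP mt] : exists t : 'S_n, m == delta_mon k t.
  apply/existsP; apply: contraR nz => /existsPn no; apply/eqP.
  rewrite DeltaE pairing_sumr big1 // => t _.
  by rewrite pairing_mon (negPf (no t)) mul0n mulr0.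
pose r := (c * t^-1)%g.
pose f := key (segment_mon k p (Des p)).
pose g i := n%:Z * zexp (segment_mon k s (~: Des s)) i + i%:Z.
(* The opposite tie-breaks cancel in the sum of the two keys. *)
have mr (j : 'I_n) : f (r j) + g (r j) = n%:Z * (k.-1%:Z - j%:Z).
  rewrite -cE -(permKV t (c j)) -[(t^-1)%g _]permM -/r -zexp_delta_mon -mt.
  by rewrite zexpD /f /g /key; lia.
have ms (j : 'I_n) : key (segment_mon k s (Des s)) (s j) + g (s j) =
    n%:Z * (k.-1%:Z - j%:Z).
  by rewrite -(zexp_full s) // -(segment_monU k s (Des s)) zexpD /g /key; lia.
have bal : \sum_(j < n) j%:Z * f (r j) + \sum_(j < n) j%:Z * g (r j) =
    descent_weight k s + \sum_(j < n) j%:Z * g (s j).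
  rewrite -!big_split /=; apply: eq_bigr => j _.
  by rewrite -!mulrDr mr ms.
have := @rearrangement _ _ _ r (@sorts_descent_key n k p).
have := @rearrangement _ _ _ r (@sorts_ascent_key n k s).
rewrite -/(descent_weight k p) -/f -/g => gs fp.
have [rs|/gs lt2] := eqVneq r s.
  have /fp : r != p by rewrite rs eq_sym.
  by move: bal; rewrite [in X in _ + X = _]rs => /addIr ->.
have [rp|/fp lt1] := eqVneq r p.
  by rewrite -(ltrD2r (\sum_(j < n) j%:Z * g (s j))) -bal rp ltrD2l -rp.
by rewrite -(ltrD2r (\sum_(j < n) j%:Z * g (s j))) -bal; apply: ltrD.
Qed.

Lemma descent_independent n k (c : 'S_n -> rat) : (1 <= k)%N -> (k <= n)%N ->
  \sum_p c p *: proj k (descent_monomial k p) = 0 -> forall p, c p = 0.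
Proof.
move=> hk hkn c0 p1; apply/eqP; apply: contraT => np1.
(* Pairing with the complementary monomial of a permutation of least weight
   isolates its coefficient. *)
have [s ns smin] : exists2 s, c s != 0 &
    forall p, c p != 0 -> descent_weight k s <= descent_weight k p.
  by case: (@arg_minP _ _ _ p1 (fun p => c p != 0) (@descent_weight n k) np1) => s; exists s.
have inJ : \sum_p c p *: descent_monomial k p \in J n k.
  rewrite -[X in X \in _]subr0; apply/proj_eq; rewrite linear0 -c0 linear_sum.
  by apply: eq_bigr => p _; rewrite linearZ.
have := J_pairing (segment_mon k s (~: Des s)) inJ.
rewrite mulr_sumr pairing_suml (bigD1 s) //= big1 => [|p neps].
  move/eqP; rewrite addr0 -scalerAr -[_ *: _]addr0 pairing_linear.
  rewrite {2}/pairing diffop0 mcoeff0 addr0 descent_monomialE // -mpolyXD addmC.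
  by rewrite segment_monU mulf_eq0 (negPf ns) (negPf (pairing_full s hk hkn)).
rewrite -scalerAr -[_ *: _]addr0 pairing_linear {2}/pairing diffop0 mcoeff0 addr0.
rewrite descent_monomialE // -mpolyXD addmC.
have [->|np] := eqVneq (c p) 0; first by rewrite mul0r.
apply/eqP; rewrite mulf_eq0 (negPf np) /=; apply: contraT => nz.
by have := pairing_triangular hk hkn nz neps; rewrite ltNge smin.
Qed.

Theorem theorem1p3 (n k : nat) (hk : (1 <= k)%N) (hkn : (k <= n)%N) :
  is_basis (fun p : 'S_n => proj k (descent_monomial k p)).
Proof.
split=> [c|v]; first exact: descent_independent.
have [c cE] : spanned k (repr (v : {ideal_quot (J n k)})).
  rewrite [repr _]mpolyE; apply: spanned_sum => m _.
  rewrite -[_ *: _]addr0; apply: spannedD; first exact: spanned_mon.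
  by apply: spanned_J; have [] := J_submod n k.
by exists c; rewrite -cE proj_surj.
Qed.
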